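(* Let $r$ and $s$ be positive integers with $r\equiv2\pmod 6$ and $s\equiv1\pmod 6$, or with $r\equiv5\pmod 6$, $s\equiv1\pmod 6$, and $s\ge7$. Then the Apéry numbers $a_n(r,s)$, $n\ge 0$, obey the following congruences modulo $9$: (i) $a_n(r,s)\equiv 1\pmod 9$ if, and only if, the $3$-adic expansion of $n$ contains $0$'s and $2$'s only; (ii) $a_n(r,s)\equiv 3\pmod 9$ if, and only if, the $3$-adic expansion of $n$ has exactly one occurrence of the string $01$ (including an occurrence of a $1$ at the beginning) and otherwise contains only $0$'s and $2$'s; (iii) $a_n(r,s)\equiv 6\pmod 9$ if, and only if, the $3$-adic expansion of $n$ has exactly one occurrence of the string $21$ and otherwise contains only $0$'s and $2$'s; (iv) in the cases not covered by Items (i)--(iii), $a_n(r,s)$ is divisible by $9$; in particular, $a_n(r,s)\not\equiv 2,4,5,7,8\pmod 9$ for all $n$.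
   Context: For non-negative integers $r,s,n$, the (generalised) Apéry numbers are $a_n(r,s)=\sum_{k=0}^n\binom nk^r\binom{n+k}k^s$. The $3$-adic expansion of $n$ is its base-$3$ representation $n=\sum_i n_i3^i$ with $0\le n_i\le 2$, written with the most significant digit first and without leading zeros; a string $ab$ occurs if $n_\nu=a$ and $n_{\nu-1}=b$ for some $\nu\ge1$. The ''beginning'' is the leading (most significant) digit. ''Otherwise contains only $0$'s and $2$'s'' means that all digits outside the mentioned occurrence of the string are $0$ or $2$. *)

(* Defs.v *)
From mathcomp Require Import all_boot.

Set Implicit Arguments.
Unset Strict Implicit.
Unset Printing Implicit Defensive.

Definition apery (r s n : nat) : nat :=
  \sum_(k < n.+1) 'C(n, k) ^ r * 'C(n + k, k) ^ s.

(* [digit3 n i] is n_i in n = \sum_i n_i 3^i; the expansion of n consists of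
   the n_i with i < size3 n, the leading one being n_(size3 n - 1).  Since
   [trunc_log 3 0 = 0], the expansion of 0 is the one-digit string "0". *)
Definition digit3 (n i : nat) : nat := (n %/ 3 ^ i) %% 3.

Definition size3 (n : nat) : nat := (trunc_log 3 n).+1.

(* The string ab occurs at nu: n_nu = a and n_(nu-1) = b; both digits have to
   belong to the expansion. *)
Definition occurs3 (a b n nu : nat) : Prop :=
  [/\ 1 <= nu, nu < size3 n, digit3 n nu = a & digit3 n nu.-1 = b].

(* An occurrence of 01, where a leading digit 1 counts as an occurrence; the
   latter has nu = size3 n, so its (absent) 0 lies just in front of the
   expansion. *)
Definition occurs01 (n nu : nat) : Prop :=
  occurs3 0 1 n nu \/ nu = size3 n /\ digit3 n nu.-1 = 1.

Definition only02 (n : nat) : Prop :=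
  forall i, i < size3 n -> digit3 n i = 0 \/ digit3 n i = 2.

(* There is exactly one nu at which [occ] holds, and all digits of n outside
   positions nu and nu - 1 are 0 or 2. *)
Definition once_otherwise02 (occ : nat -> Prop) (n : nat) : Prop :=
  exists nu, [/\ occ nu, (forall mu, occ mu -> mu = nu)
    & forall i, i < size3 n -> i <> nu -> i <> nu.-1 ->
        digit3 n i = 0 \/ digit3 n i = 2].

Definition one01 (n : nat) : Prop := once_otherwise02 (occurs01 n) n.

Definition one21 (n : nat) : Prop := once_otherwise02 (occurs3 2 1 n) n.

(* Main.v *)
(* Modulo 9 one has 'C(3n, 3j) = 'C(n, j), so that the binomials with arguments
   3n + d and 3j + e are explicit multiples of 'C(n, j); those with a factor 3
   disappear when raised to a power at least 2.  Summing over k = 3j + e gives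
     a_(3n) = a_n,  a_(3n+1) = (3 + 6n) a_n,  a_(3n+2) = a_n   (mod 9).
   Hence the digits 0 and 2 do not change a_n mod 9, and a digit 1 multiplies
   it by 3 after a 0, by 6 after a 2, and by a multiple of 3 in general. *)
Require Import Defs.
From mathcomp Require Import all_boot all_algebra ring zify.
Import GRing.Theory.

Set Implicit Arguments.
Unset Strict Implicit.
Unset Printing Implicit Defensive.

(** * Arithmetic in Z/9 *)

Local Open Scope ring_scope.

(** Since [ring] does not use that 9 vanishes, each congruence is given an explicit witness [z], the
    difference of the two sides divided by 9. *)
Lemma eq_mod9 (z x y : 'Z_9) : x = y + 9 * z -> x = y.
Proof. by rewrite (_ : 9 = 0) ?mul0r ?addr0 //; apply: (@pchar_Zp 9). Qed.

(** The inverse comes from (1 + 3a)(1 - 3a) = 1 - 9a^2. *)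
Lemma divr_3x1 (a x y : 'Z_9) : (3 * a + 1) * x = y -> x = (1 - 3 * a) * y.
Proof. by move=> <-; apply: (@eq_mod9 (a ^+ 2 * x)); ring. Qed.

Lemma divr_3x2 (a x y : 'Z_9) : (3 * a + 2) * x = y -> x = (5 - 3 * a) * y.
Proof. by move=> <-; apply: (@eq_mod9 ((a ^+ 2 - a - 1) * x)); ring. Qed.

(** * Binomial coefficients modulo 3 and 9 *)

Lemma dvd3_bin n k : ~~ (3 %| k)%N -> (3 %| 'C(3 * n, k))%N.
Proof.
case: k => [//|k] Hk.
rewrite -(@Gauss_dvdr 3 k.+1) ?prime_coprime // -mul_bin_diag.
by rewrite -mulnA dvdn_mulr.
Qed.

(** Pascal's rule applied three times gives the coefficients 1, 3, 3, 1; the two middle binomials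
    are themselves divisible by 3, so what remains is Pascal's rule for ['C(n, j)]. *)
Lemma bin_3x3 n j : 'C(3 * n, 3 * j)%:R = 'C(n, j)%:R :> 'Z_9.
Proof.
elim: n j => [|n IHn] [|j]; rewrite ?muln0 ?bin0 // ?mulnS ?bin0n //.
have /dvdnP[x Hx] : (3 %| 'C(3 * n, 3 * j + 2))%N by apply: dvd3_bin; lia.
have /dvdnP[y Hy] : (3 %| 'C(3 * n, 3 * j + 1))%N by apply: dvd3_bin; lia.
have -> : ('C(3 + 3 * n, 3 + 3 * j) = 'C(3 * n, 3 * j.+1)
    + 3 * ('C(3 * n, 3 * j + 2) + 'C(3 * n, 3 * j + 1)) + 'C(3 * n, 3 * j))%N.
  by rewrite mulnS addn2 addn1 !addSn !add0n !binS; lia.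
rewrite binS natrD natrD natrM natrD !IHn Hx Hy !natrM [RHS]natrD.
by apply: (@eq_mod9 (x%:R + y%:R)); ring.
Qed.

(** From here on, each binomial is obtained from an earlier one by an absorption identity, whose
    cofactor 3a + 1 or 3a + 2 is a unit modulo 9. *)
Lemma bin_3x1_3x n j :
  'C((3 * n).+1, 3 * j)%:R = (1 + 3 * j%:R) * 'C(n, j)%:R :> 'Z_9.
Proof.
have [ltnj|] := ltnP n j; first by rewrite !bin_small ?mulr0 //; lia.
(* Writing n = j + d avoids truncated subtraction in the cofactor. *)
move=> /subnKC; move: (n - j)%N => d <-.
have := congr1 (fun m => m%:R : 'Z_9) (mul_bin_down (3 * (j + d)).+1 (3 * j)).
rewrite (_ : (3 * (j + d)).+1 - 3 * j = 3 * d + 1)%N; last lia.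
rewrite !natrM natrD natrM /= bin_3x3 => /esym/divr_3x1->.
set c := 'C(_, _)%:R.
by apply: (@eq_mod9 (- (d%:R * (j%:R + d%:R)) * c)); ring.
Qed.

Lemma bin_3x1_3x1 n j :
  'C((3 * n).+1, (3 * j).+1)%:R = (1 + 3 * (n%:R - j%:R)) * 'C(n, j)%:R :> 'Z_9.
Proof.
have := congr1 (fun m => m%:R : 'Z_9) (mul_bin_diag (3 * n).+1 (3 * j)).
rewrite !natrM -(addn1 (3 * j)) [(_ + 1)%:R]natrD natrM /= bin_3x3.
move=> /esym/divr_3x1->.
by apply: (@eq_mod9 (- (n%:R * j%:R) * 'C(n, j)%:R)); ring.
Qed.

Lemma bin_3x2_3x n j : 'C((3 * n).+2, 3 * j)%:R = 'C(n, j)%:R :> 'Z_9.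
Proof.
have [ltnj|] := ltnP n j; first by rewrite !bin_small //; lia.
move=> /subnKC; move: (n - j)%N => d <-.
have := congr1 (fun m => m%:R : 'Z_9) (mul_bin_down (3 * (j + d)).+2 (3 * j)).
rewrite (_ : (3 * (j + d)).+2 - 3 * j = 3 * d + 2)%N; last lia.
rewrite !natrM natrD natrM /= bin_3x1_3x => /esym/divr_3x2->.
set c := 'C(_, _)%:R; set x := j%:R; set y := d%:R.
apply: (@eq_mod9 ((1 + 5 * x + y + 5 * x ^+ 2 + 2 * x * y - y ^+ 2
  - 3 * x * y * (x + y)) * c)); ring.
Qed.

Lemma bin_3x2_3x1 n j :
  'C((3 * n).+2, (3 * j).+1)%:R = (2 + 3 * n%:R) * 'C(n, j)%:R :> 'Z_9.
Proof.
have := congr1 (fun m => m%:R : 'Z_9) (mul_bin_diag (3 * n).+2 (3 * j)).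
rewrite !natrM -(addn1 (3 * j)) [(_ + 1)%:R]natrD natrM /= bin_3x1_3x.
move=> /esym/divr_3x1->.
by apply: (@eq_mod9 (- (j%:R ^+ 2 * (2 + 3 * n%:R)) * 'C(n, j)%:R)); ring.
Qed.

Lemma bin_3x3_3x1 n j :
  'C((3 * n).+3, (3 * j).+1)%:R = 3 * (1 + n%:R) * 'C(n, j)%:R :> 'Z_9.
Proof.
have := congr1 (fun m => m%:R : 'Z_9) (mul_bin_diag (3 * n).+3 (3 * j)).
rewrite !natrM -(addn1 (3 * j)) [(_ + 1)%:R]natrD natrM /= bin_3x2_3x.
move=> /esym/divr_3x1->.
by apply: (@eq_mod9 (- (j%:R * (1 + n%:R)) * 'C(n, j)%:R)); ring.
Qed.

Lemma bin_3x2_3x2 n j :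
  'C((3 * n).+2, (3 * j).+2)%:R
  = 'C(n, j)%:R :> 'Z_9.
Proof.
have := congr1 (fun m => m%:R : 'Z_9) (mul_bin_diag (3 * n).+2 (3 * j).+1).
rewrite !natrM -(addn2 (3 * j)) [(_ + 2)%:R]natrD natrM /= bin_3x1_3x1.
move=> /esym/divr_3x2->.
set c := 'C(_, _)%:R; set x := n%:R; set y := j%:R.
apply: (@eq_mod9 ((1 + 5 * x - 4 * y + 5 * x ^+ 2 - 8 * x * y + 2 * y ^+ 2
  - 3 * x * y * (x - y)) * c)); ring.
Qed.

Lemma bin_3x4_3x2 n j :
  'C((3 * n).+4, (3 * j).+2)%:R = 6 * (1 + n%:R) * 'C(n, j)%:R :> 'Z_9.
Proof.
have := congr1 (fun m => m%:R : 'Z_9) (mul_bin_diag (3 * n).+4 (3 * j).+1).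
rewrite !natrM -(addn2 (3 * j)) [(_ + 2)%:R]natrD natrM /= bin_3x3_3x1.
move=> /esym/divr_3x2->.
set c := 'C(_, _)%:R; set x := n%:R; set y := j%:R.
apply: (@eq_mod9 ((6 + 5 * x - 4 * y - 3 * x * y) * (1 + x) * c)); ring.
Qed.

(** * Powers in Z/9 *)

Lemma expr_3x (x : 'Z_9) r : (1 < r)%N -> (3 * x) ^+ r = 0.
Proof.
case: r => [|[|r]] // _; rewrite exprSr exprSr -mulrA.
by apply: (@eq_mod9 ((3 * x) ^+ r * (x * x))); ring.
Qed.

Lemma expr_dvd3 m r : (3 %| m)%N -> (1 < r)%N -> m%:R ^+ r = 0 :> 'Z_9.
Proof. by case/dvdnP=> q ->; rewrite mulnC natrM; apply: expr_3x. Qed.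

Lemma expr_1p3x (x : 'Z_9) p e : (1 + 3 * x) ^+ (3 * p + e) = (1 + 3 * x) ^+ e.
Proof.
rewrite exprD exprM (_ : _ ^+ 3 = 1) ?expr1n ?mul1r //.
by apply: (@eq_mod9 (x + 3 * x ^+ 2 + 3 * x ^+ 3)); ring.
Qed.

(** The unit group modulo 9 has order 6; this is how residues of exponents modulo 6 enter. *)
Lemma expr_2p3x (x : 'Z_9) q e : (2 + 3 * x) ^+ (6 * q + e) = (2 + 3 * x) ^+ e.
Proof.
rewrite exprD exprM (_ : _ ^+ 6 = 1) ?expr1n ?mul1r //.
apply: (@eq_mod9 (7 + 64 * x + 240 * x ^+ 2 + 480 * x ^+ 3 + 540 * x ^+ 4
  + 324 * x ^+ 5 + 81 * x ^+ 6)); ring.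
Qed.

(** * Recurrences for the Apéry numbers modulo 9 *)

Lemma big_ord_mul3 (F : nat -> nat) m :
  (\sum_(k < 3 * m) F k
   = \sum_(j < m) (F (3 * j) + F (3 * j).+1 + F (3 * j).+2))%N.
Proof.
elim: m => [|m IHm]; first by rewrite !big_ord0.
by rewrite mulnS addnC addn3 !big_ord_recr /= IHm !addnA.
Qed.

Definition apery_term r s n k := ('C(n, k) ^ r * 'C(n + k, k) ^ s)%N.

(** The sum is padded up to k < 3(n + 1); the added terms vanish because ['C(3 * n + d, k)] is 0
    there and r > 0. *)
Lemma apery_mul3 r s n d : (0 < r)%N -> (d < 3)%N ->
  (apery r s (3 * n + d) = \sum_(j < n.+1)
    (apery_term r s (3 * n + d) (3 * j) + apery_term r s (3 * n + d) (3 * j).+1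
     + apery_term r s (3 * n + d) (3 * j).+2))%N.
Proof.
move=> r_gt0 d_lt3; rewrite -big_ord_mul3 /apery.
have le_n : ((3 * n + d).+1 <= 3 * n.+1)%N by lia.
rewrite -[LHS](big_mkord xpredT (apery_term r s (3 * n + d))).
rewrite (big_nat_widen _ _ _ _ _ le_n) /= big_mkord.
rewrite big_mkcond; apply: eq_bigr => k _; case: ltnP => // ltk.
by rewrite /apery_term bin_small // exp0n.
Qed.

Lemma natr_apery r s n :
  (apery r s n)%:R
  = \sum_(j < n.+1) 'C(n, j)%:R ^+ r * 'C(n + j, j)%:R ^+ s :> 'Z_9.
Proof. by rewrite natr_sum; apply: eq_bigr => j _; rewrite natrM !natrX. Qed.

Lemma dvd3_bin1 n j : (3 %| 'C((3 * n).+1, (3 * j).+2))%N.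
Proof. by rewrite binS dvdn_add // dvd3_bin //; lia. Qed.

Lemma apery_3x r s n : (1 < r)%N ->
  (apery r s (3 * n))%:R = (apery r s n)%:R :> 'Z_9.
Proof.
move=> r_gt1; rewrite -[(3 * n)%N]addn0 apery_mul3 ?(ltnW r_gt1) // addn0.
rewrite natr_sum natr_apery; apply: eq_bigr => j _.
rewrite /apery_term !natrD !natrM !natrX -mulnDr !bin_3x3.
have bin_r0 k : ~~ (3 %| k)%N -> 'C(3 * n, k)%:R ^+ r = 0 :> 'Z_9.
  by move=> Hk; rewrite expr_dvd3 ?dvd3_bin.
rewrite (bin_r0 (3 * j).+1) ?(bin_r0 (3 * j).+2) ?mul0r ?addr0 //; lia.
Qed.

(** Relative to the j-th term of a_n, k = 3j gives (1 + 3j)^(2+1) = 1, k = 3j + 1 gives (1 + 3(n -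
    j))^2 (2 + 3(n + j)) = 2 + 6n, and k = 3j + 2 gives 0. *)
Lemma apery_3x1 p q n (r := (3 * p + 2)%N) (s := (6 * q + 1)%N) :
  (apery r s (3 * n + 1))%:R = (3 + 6 * n%:R) * (apery r s n)%:R :> 'Z_9.
Proof.
have r_gt1 : (1 < r)%N by rewrite /r; lia.
rewrite apery_mul3 ?(ltnW r_gt1) // addn1 natr_sum natr_apery mulr_sumr.
apply: eq_bigr => j _.
rewrite /apery_term !natrD !natrM !natrX.
rewrite (expr_dvd3 (dvd3_bin1 n j)) // mul0r addr0.
rewrite (_ : (3 * n).+1 + 3 * j = (3 * (n + j)).+1)%N; last lia.
rewrite (_ : (3 * n).+1 + (3 * j).+1 = (3 * (n + j)).+2)%N; last lia.
rewrite !bin_3x1_3x bin_3x1_3x1 bin_3x2_3x1 !exprMn !natrD.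
(* This base has period 3, so 6q + 1 is read as 3(2q) + 1. *)
have -> : (1 + 3 * j%:R) ^+ s = 1 + 3 * j%:R :> 'Z_9.
  by rewrite /s -[6%N]/(3 * 2)%N -mulnA expr_1p3x.
rewrite /r /s !expr_1p3x expr_2p3x !expr1.
set A := _ ^+ (3 * p + 2); set B := 'C(n + j, j)%:R ^+ _.
set x := n%:R; set y := j%:R.
apply: (@eq_mod9 ((y + 3 * y ^+ 2 + 3 * y ^+ 3 + (x - y)
  + (x - y) * (2 * x + 2 * y + 2 * (x - y) + 3 * (x - y) * (x + y))) * A * B)).
ring.
Qed.

(** The hypothesis says that s >= 7 or r is even. The term k = 3j alone equals the j-th term of a_n;
    the other two carry a factor 3 from the second binomial and have to sum to 0. *)
Lemma apery_3x2 p q n (r := (3 * p + 2)%N) (s := (6 * q + 1)%N) :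
  (0 < q)%N || ~~ odd p ->
  (apery r s (3 * n + 2))%:R = (apery r s n)%:R :> 'Z_9.
Proof.
move=> Hpq; have r_gt1 : (1 < r)%N by rewrite /r; lia.
rewrite apery_mul3 ?(ltnW r_gt1) // addn2 natr_sum natr_apery.
apply: eq_bigr => j _.
rewrite /apery_term !natrD !natrM !natrX.
rewrite (_ : (3 * n).+2 + 3 * j = (3 * (n + j)).+2)%N; last lia.
rewrite (_ : (3 * n).+2 + (3 * j).+1 = (3 * (n + j)).+3)%N; last lia.
rewrite (_ : (3 * n).+2 + (3 * j).+2 = (3 * (n + j)).+4)%N; last lia.
rewrite !bin_3x2_3x bin_3x2_3x1 bin_3x2_3x2 bin_3x3_3x1 bin_3x4_3x2.
have -> : 6 * (1 + (n + j)%:R) = 3 * (2 * (1 + (n + j)%:R)) :> 'Z_9 by ring.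
rewrite -!mulrA.
have [q_gt0|] := ltnP 0%N q.
  have s_gt1 : (1 < s)%N by rewrite /s; lia.
  by rewrite !(@expr_3x _ s) // !mulr0 !addr0.
(* For s = 1 the terms k = 3j+1 and k = 3j+2 contribute 3w and 6w with
   w = (1+n+j) 'C(n, j)^r 'C(n+j, j), which cancel because r is even. *)
rewrite leqn0 => /eqP q0; move: Hpq; rewrite q0 /= => /even_halfK Hp.
(* As p is even, r has the form 6p' + 2, so (2 + 3n)^r reduces to (2 + 3n)^2. *)
rewrite /r /s q0 -Hp -mul2n mulnA !expr1 !exprMn expr_2p3x.
set A := _ ^+ (_ + 2); set B := 'C(n + j, j)%:R; rewrite natrD.
set x := n%:R; set y := j%:R.
apply: (@eq_mod9 ((1 + x + y) * (2 + 4 * x + 3 * x ^+ 2) * A * B)); ring.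
Qed.

Local Close Scope ring_scope.

Lemma natr_modn9 m n : m%:R%R = n%:R%R :> 'Z_9 <-> m = n %[mod 9].
Proof.
rewrite -(@val_Zp_nat 9) // -(@val_Zp_nat 9) //.
by split=> [-> //|/val_inj].
Qed.

(** * Base-3 digits and the position of a single 1 *)

Lemma digit3_mul3 m d : d < 3 -> digit3 (3 * m + d) 0 = d.
Proof. by move=> Hd; rewrite /digit3 expn0 divn1; lia. Qed.

Lemma digit3_mul3S m d i : d < 3 -> digit3 (3 * m + d) i.+1 = digit3 m i.
Proof. by move=> Hd; rewrite /digit3 expnS divnMA; congr (_ %/ _ %% _); lia. Qed.

Lemma digit3_size n i : size3 n <= i -> digit3 n i = 0.
Proof.
move=> Hi; rewrite /digit3 divn_small ?mod0n //.
by apply: leq_trans (leq_pexp2l _ Hi) => //; apply: trunc_log_ltn.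
Qed.

Lemma digit3_lt3 n i : digit3 n i < 3.
Proof. exact: ltn_pmod. Qed.

Lemma only02P n : only02 n <-> forall i, digit3 n i <> 1.
Proof.
split=> H i; first last.
  by move=> _; have := H i; have := digit3_lt3 n i; lia.
by have [/H|/digit3_size->//] := ltnP i (size3 n); lia.
Qed.

(* A leading 1 is covered by a = 0, since digit3 vanishes beyond size3 n. *)
Definition single1_after a n :=
  exists2 i, digit3 n i.+1 = a & forall j, digit3 n j = 1 <-> j = i.

(** An occurrence at nu puts a 1 at nu - 1; the digit at nu is a, hence not a second 1, and all
    others are 0 or 2. *)
Lemma once_otherwise02P (occ : nat -> Prop) a n : a <> 1 ->
  (forall nu, occ nu <-> [/\ 0 < nu, digit3 n nu = a & digit3 n nu.-1 = 1]) ->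
  once_otherwise02 occ n <-> single1_after a n.
Proof.
move=> a_neq1 occE; split.
  case=> nu [/occE[nu_gt0 dig_nu dig1] _ other02].
  exists nu.-1; first by rewrite prednK.
  move=> j; split=> [dig_j|->//].
  have [ltj|/digit3_size] := ltnP j (size3 n); last by rewrite dig_j.
  have [//|/eqP j_neq] := eqVneq j nu.-1.
  have [j_nu|/eqP j_neq'] := eqVneq j nu; first by rewrite -j_nu in dig_nu; lia.
  by have := other02 j ltj j_neq' j_neq; lia.
case=> i dig_i dig1; exists i.+1; split.
- by apply/occE; split=> //=; apply/dig1.
- by move=> mu /occE[mu_gt0 _ /dig1 <-]; rewrite prednK.
- move=> j _ _ /= j_neq; have := digit3_lt3 n j.
  have : digit3 n j <> 1 by move/dig1.
  by lia.
Qed.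

Lemma one01P n : one01 n <-> single1_after 0 n.
Proof.
apply: once_otherwise02P => // nu; split.
  by case=> [[? _ -> ->] //|[-> ->]]; rewrite digit3_size.
(* If nu lies beyond the expansion, the nonzero digit at nu - 1 forces nu = [size3 n]: the leading-1
   case. *)
case=> nu_gt0 dig_nu dig1; have [ltnu|lenu] := ltnP nu (size3 n); first by left.
right; split=> //; apply/eqP; rewrite eqn_leq lenu andbT leqNgt.
apply/negP=> lt_nu; suff : digit3 n nu.-1 = 0 by rewrite dig1.
by apply: digit3_size; lia.
Qed.

Lemma one21P n : one21 n <-> single1_after 2 n.
Proof.
apply: once_otherwise02P => // nu; split=> [[]//|[nu_gt0 dig_nu dig1]].
by split=> //; rewrite ltnNge; apply/negP=> /digit3_size; rewrite dig_nu.
Qed.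

Lemma only02_mul3 m d : d < 3 -> only02 (3 * m + d) <-> d <> 1 /\ only02 m.
Proof.
move=> d_lt3; rewrite !only02P; split=> [H|[d_neq1 H] [|i]].
- split=> [d1|i]; last by rewrite -(digit3_mul3S m _ d_lt3).
  by apply: (H 0); rewrite digit3_mul3.
- by rewrite digit3_mul3.
- by rewrite digit3_mul3S.
Qed.

Lemma single1_after_mul3 a m d : d < 3 -> d <> 1 ->
  single1_after a (3 * m + d) <-> single1_after a m.
Proof.
move=> d_lt3 d_neq1; split=> [][i].
- rewrite digit3_mul3S // => dig_i dig1; case: i dig_i dig1 => [|i] dig_i dig1.
    by case: d_neq1; rewrite -(digit3_mul3 m d_lt3); apply/dig1.
  exists i => // j; rewrite -(digit3_mul3S m j d_lt3) dig1.
  by split=> [[]|->].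
- move=> dig_i dig1; exists i.+1; rewrite ?digit3_mul3S // => -[|j].
    by rewrite digit3_mul3.
  by rewrite digit3_mul3S // dig1; split=> [->|[]].
Qed.

(** The appended 1 sits at position 0, so it must be the unique 1 and m has none. *)
Lemma single1_after_mul3_1 a m :
  single1_after a (3 * m + 1) <-> digit3 m 0 = a /\ only02 m.
Proof.
rewrite only02P; split.
- case=> i dig_i dig1.
  have i0 : i = 0 by apply/esym/dig1; rewrite digit3_mul3.
  rewrite i0 digit3_mul3S // in dig_i; split=> // j.
  by rewrite -(@digit3_mul3S m 1) // => /dig1; rewrite i0.
- case=> dig0 dig_neq1; exists 0; rewrite ?digit3_mul3S // => -[|j].
    by rewrite digit3_mul3.
  by rewrite digit3_mul3S //; split=> // /dig_neq1.
Qed.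

(** * From the recurrence to the digit description *)

(** The membership clause forces v = 0 once the three digit patterns are excluded. *)
Definition digit_rule v n :=
  [/\ v = 1 <-> only02 n, v = 3 <-> one01 n, v = 6 <-> one21 n
    & v \in [:: 0; 1; 3; 6]].

Lemma digit_rule_of_recurrence (v : nat -> nat) :
  v 0 = 1 -> (forall m, v (3 * m) = v m) -> (forall m, v (3 * m + 2) = v m) ->
  (forall m, v (3 * m + 1) = (3 + 6 * m) * v m %% 9) ->
  forall n, digit_rule (v n) n.
Proof.
move=> v0 v3x v3x2 v3x1; elim/ltn_ind=> n IHn.
have dig0 i : digit3 0 i = 0 by rewrite /digit3 div0n.
have rule02 m d : d < 3 -> d <> 1 -> v (3 * m + d) = v m ->
    digit_rule (v m) m -> digit_rule (v (3 * m + d)) (3 * m + d).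
  move=> d_lt3 d_neq1 -> [o2 o01 o21 vE]; split=> //.
  - by rewrite o2 only02_mul3 //; split=> [|[]].
  - by rewrite o01 !one01P single1_after_mul3.
  - by rewrite o21 !one21P single1_after_mul3.
have [->|n_gt0] := posnP n.
  rewrite v0; split; rewrite ?one01P ?one21P //; split=> //.
  - by move=> _; apply/only02P=> i; rewrite dig0.
  - by case=> i _ /(_ i)[_ /(_ erefl)]; rewrite dig0.
  - by case=> i; rewrite dig0.
have [m nE] : exists m, n = 3 * m + n %% 3 by exists (n %/ 3); lia.
have IHm : digit_rule (v m) m by apply: IHn; lia.
have : n %% 3 < 3 by rewrite ltn_pmod.
move: (n %% 3) nE => d ->; case: d => [|[|[|//]]] _.
- by apply: rule02; rewrite ?addn0.
- case: IHm => o2 _ _; rewrite !inE v3x1 => vE.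
  (* If v m = 1, the last digit of m is 0 or 2, and 3 + 6m is 3 or 6 modulo 9 accordingly. *)
  have [v1|/eqP v_neq1] := eqVneq (v m) 1.
    have := o2.1 v1; rewrite only02P => /(_ 0).
    rewrite v1 /digit3 expn0 divn1 => m_neq1.
    split; rewrite ?only02_mul3 ?one01P ?one21P ?single1_after_mul3_1 -?o2
      /digit3 ?expn0 ?divn1 ?inE //; lia.
  (* Here both factors are divisible by 3, and m already contains a 1, so no pattern fits. *)
  have -> : (3 + 6 * m) * v m %% 9 = 0.
    by case/or4P: vE v_neq1 => /eqP-> //; lia.
  split; rewrite ?only02_mul3 ?one01P ?one21P ?single1_after_mul3_1 -?o2 //; lia.
- by apply: rule02.
Qed.

Theorem corollary24 (r s : nat) (hr : 0 < r) (hs : 0 < s)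
  (hrs : (r = 2 %[mod 6] /\ s = 1 %[mod 6]) \/
         [/\ r = 5 %[mod 6], s = 1 %[mod 6] & 7 <= s]) :
  forall n : nat,
    [/\ apery r s n = 1 %[mod 9] <-> only02 n,
        apery r s n = 3 %[mod 9] <-> one01 n,
        apery r s n = 6 %[mod 9] <-> one21 n
      & (~ only02 n -> ~ one01 n -> ~ one21 n -> 9 %| apery r s n) /\
        (forall c : nat, c \in [:: 2; 4; 5; 7; 8] ->
           apery r s n <> c %[mod 9])].
Proof.
have [p [q [rE sE Hpq]]] : exists p q,
    [/\ r = 3 * p + 2, s = 6 * q + 1 & (0 < q) || ~~ odd p].
  (* In both cases r = 2 modulo 3; r = 2 modulo 6 makes p even, while s >= 7 gives q > 0. *)
  exists (r %/ 3), (s %/ 6); case: hrs => [[r2 s1]|[r5 s1 s7]].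
    by split; last (apply/orP; right; rewrite -dvdn2); lia.
  by split; last (apply/orP; left); lia.
have rule : forall n, digit_rule (apery r s n %% 9) n.
  apply: digit_rule_of_recurrence => [|m|m|m].
  - by rewrite /apery big_ord1 !bin0 !exp1n.
  - by apply/natr_modn9/apery_3x; lia.
  - by apply/natr_modn9; rewrite rE sE apery_3x2.
  - rewrite modnMmr; apply/natr_modn9.
    by rewrite rE sE apery_3x1 natrM natrD natrM.
move=> n; have [o2 o01 o21] := rule n; rewrite !inE => vE; split=> //; split.
  move=> /o2 v1 /o01 v3 /o21 v6; rewrite /dvdn.
  by case/or4P: vE => /eqP vE; rewrite vE // in v1 v3 v6 *.
move=> c cE vc; move: cE; rewrite !inE.
case/or4P: vE => /eqP; rewrite vc => vE;
by case/or4P=> [/eqP cE|/eqP cE|/eqP cE|/orP[/eqP cE|/eqP cE]]; rewrite cE in vE.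
Qed.
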